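(* For every $A\ge 1$ there is a constant $c=c(A)>0$ such that for every $0<\varepsilon<1$ and every integer $i$ with $\frac{1}{A\varepsilon}\le i\le\frac{A}{\varepsilon}$, every embedding of the metric space $(G_i,d_{G_i}^{1-\varepsilon})$ into $\ell_2$ has distortion at least $c/\sqrt{\varepsilon}$, where $G_i$ is the $i$-th Laakso graph with its metric $d_{G_i}$.
   Context: The Laakso graphs $\{G_i\}_{i\ge 0}$, with their shortest-path metrics, are defined recursively. $G_0$ is the graph on two vertices (its endpoints) joined by one edge of length $1$. To construct $G_i$, take six copies of $G_{i-1}$, scale their metric by a factor of $\frac14$, glue four of them cyclically by identifying pairs of endpoints, and attach at two opposite gluing points the remaining two copies. Explicitly: take points $p_0,p_1,a,b,p_2,p_3$ and place a $\frac14$-scaled copy of $G_{i-1}$, with its two endpoints identified with the two points of the pair, between each of the pairs $(p_0,p_1),(p_1,a),(a,p_2),(p_1,b),(b,p_2),(p_2,p_3)$; the endpoints of $G_i$ are $p_0$ and $p_3$. An embedding $f$ of a metric space $(X,\rho)$ into $\ell_2$ has distortion equal to the least $D$ such that for some $s>0$, $s\,\rho(x,y)\le\|f(x)-f(y)\|_2\le D s\,\rho(x,y)$ for all $x,y\in X$ ($D=\infty$ if there is none). *)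

(* Defs.v *)
From mathcomp Require Import all_boot all_order all_algebra.
From mathcomp Require Import all_classical all_reals all_analysis.

Set Implicit Arguments.
Unset Strict Implicit.
Unset Printing Implicit Defensive.
Import Order.TTheory GRing.Theory Num.Theory.

Local Open Scope ring_scope.
Local Open Scope classical_set_scope.

Record stgraph := STGraph {
  vertex : finType;
  edge : rel vertex;
  src : vertex;
  snk : vertex }.

Arguments edge : clear implicits.
Arguments src : clear implicits.
Arguments snk : clear implicits.

Definition p0 : 'I_6 := @Ordinal 6 0 isT.
Definition p1 : 'I_6 := @Ordinal 6 1 isT.
Definition pa : 'I_6 := @Ordinal 6 2 isT.
Definition pb : 'I_6 := @Ordinal 6 3 isT.
Definition p2 : 'I_6 := @Ordinal 6 4 isT.
Definition p3 : 'I_6 := @Ordinal 6 5 isT.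

Definition slot (k : 'I_6) : 'I_6 * 'I_6 :=
  tnth [tuple (p0, p1); (p1, pa); (pa, p2); (p1, pb); (pb, p2); (p2, p3)] k.

Definition inner (G : stgraph) : finType :=
  {v : vertex G | (v != src G) && (v != snk G)}.

(* The disjoint union of six copies of G with endpoints identified as
   prescribed by [slot]: what remains are the six gluing points and six copies
   of the non-endpoints of G. *)
Definition glue_vertex (G : stgraph) : finType := ('I_6 + 'I_6 * inner G)%type.

(* The image in the glued graph of the vertex v of the k-th copy of G. *)
Definition place (G : stgraph) (k : 'I_6) (v : vertex G) : glue_vertex G :=
  if (insub v : option (inner G)) is Some w then inr (k, w)
  else inl (if v == src G then (slot k).1 else (slot k).2).

Definition glue_edge (G : stgraph) : rel (glue_vertex G) :=
  fun x y => [exists k, [exists u, [exists v,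
    [&& edge G u v, x == place k u & y == place k v]]]].

Definition glue (G : stgraph) : stgraph :=
  @STGraph (glue_vertex G) (@glue_edge G) (inl p0) (inl p3).

Fixpoint laakso (i : nat) : stgraph :=
  if i is j.+1 then glue (laakso j)
  else @STGraph bool (fun u v => u != v) false true.

(* After i rescalings by 1/4, each edge of the i-th graph has length 4 ^- i.
   The set of walks is nonempty by [laakso_connected] below. *)
Definition laakso_dist (R : realType) (i : nat) (x y : vertex (laakso i)) : R :=
  inf [set (size p)%:R / 4 ^+ i
      | p in [set p : seq (vertex (laakso i)) |
               path (edge (laakso i)) x p /\ last x p = y]].

Arguments laakso_dist : clear implicits.

(* Null sets for the counting measure are empty, so elements of this type are
   square-summable sequences and not classes of them. *)
Definition ell2 (R : realType) := LfunType (@counting nat R) (lee1n 2).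

Definition ell2_norm (R : realType) (u : ell2 R) : R :=
  fine ('N[@counting nat R]_2%:E[EFin \o u])%E.

Lemma ell2_norm_sqr (R : realType) (u : ell2 R) :
  ((ell2_norm u ^+ 2)%:E = \sum_(n <oo) (u n ^+ 2)%:E)%E.
Proof.
have n0 : 0 <= ell2_norm u by apply: fine_ge0; exact: Lnorm_ge0.
rewrite -powR_mulrn// -poweR_EFin {n0}/ell2_norm.
rewrite (finite_norm_fine u) poweR_Lnorm//.
rewrite ge0_integral_count//; last by move=> k; exact: poweR_ge0.
by apply: eq_eseriesr => k _; rewrite /= powR_mulrn// real_normK// num_real.
Qed.

(* The infimum of the empty set is +oo in the extended reals. *)
Definition distortion (R : realType) (X : Type) (rho : X -> X -> R)
    (f : X -> ell2 R) : \bar R :=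
  ereal_inf [set D%:E | D in [set D : R |
    exists2 s : R, 0 < s & forall x y : X,
      s * rho x y <= ell2_norm (f x - f y) <= D * s * rho x y]].

Lemma place_src (G : stgraph) k : place k (src G) = inl (slot k).1.
Proof. by rewrite /place insubF ?eqxx. Qed.

Lemma place_snk (G : stgraph) k : src G != snk G ->
  place k (snk G) = inl (slot k).2.
Proof.
by move=> st; rewrite /place insubF ?eqxx ?andbF// eq_sym (negbTE st).
Qed.

Lemma place_inner (G : stgraph) k (w : inner G) :
  place k (val w) = inr (k, w).
Proof. by rewrite /place valK. Qed.

Lemma laakso_src_snk i : src (laakso i) != snk (laakso i).
Proof. by case: i. Qed.

Lemma laakso_edge_sym i : symmetric (edge (laakso i)).
Proof.
elim: i => [|i IH] x y /=; first by rewrite eq_sym.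
by apply/idP/idP => /existsP[k /existsP[u /existsP[v /and3P[uv xu yv]]]];
  apply/existsP; exists k; apply/existsP; exists v; apply/existsP; exists u;
  rewrite IH uv xu yv.
Qed.

Lemma laakso_connect_src i x : connect (edge (laakso i)) (src (laakso i)) x.
Proof.
elim: i x => [|i IH] x /=.
  by case: x; [exact: connect1 | exact: connect0].
set G := laakso i in IH *; have st : src G != snk G := laakso_src_snk i.
pose C := connect (@glue_edge G).
have Cplace k v : C (inl (slot k).1) (place k v).
  have /connectP[p] := IH v.
  rewrite -(place_src G k); elim: p (src G) v => [|z p IHp] u v /=.
    by move=> _ ->; exact: connect0.
  move=> /andP[uz pz] lz; apply: (connect_trans _ (IHp z v pz lz)).
  apply: connect1; apply/existsP; exists k; apply/existsP; exists u.
  by apply/existsP; exists z; rewrite uz !eqxx.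
have Cslot k : C (inl (slot k).1) (inl (slot k).2).
  by rewrite -(place_snk k st).
have C1 : C (inl p0) (inl p1) := Cslot p0.
have Ca : C (inl p0) (inl pa) := connect_trans C1 (Cslot p1).
have C2 : C (inl p0) (inl p2) := connect_trans Ca (Cslot pa).
have Cb : C (inl p0) (inl pb) := connect_trans C1 (Cslot pb).
have C3 : C (inl p0) (inl p3) := connect_trans C2 (Cslot p3).
have Cpt q : C (inl p0) (inl q).
  case: q => [] [|[|[|[|[|[|//]]]]]] q6; rewrite (bool_irrelevance q6 isT) //.
  exact: connect0.
case: x => [q|[k w]]; first exact: Cpt.
by apply: (connect_trans (Cpt (slot k).1)); rewrite -place_inner.
Qed.

Lemma laakso_connected i x y :
  exists2 p, path (edge (laakso i)) x p & last x p = y.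
Proof.
have sC := sym_connect_sym (@laakso_edge_sym i).
have /connectP[p pp yp] : connect (edge (laakso i)) x y.
  by rewrite (connect_trans _ (laakso_connect_src y))// sC laakso_connect_src.
by exists p.
Qed.

(* Main.v *)
(** Apply the pointwise inequality on the six gluing points, whose only negative
    term is the diagonal |f a - f b|^2, to every glued copy at every scale.  Each
    of the i scales then costs at least s^2 / 2 in the mean of the normalized
    squared edge lengths: |f a - f b| >= s d(a, b)^(1 - eps) >= s d(a, b), since
    d(a, b) <= 1.  The normalized squared edge length at the finest scale is at
    most D^2 s^2 16^(i eps), so that D^2 16^A >= i / 2. *)

Require Import Defs.
From mathcomp Require Import all_boot all_order all_algebra.
From mathcomp Require Import all_classical all_reals all_analysis.
From mathcomp Require Import ring lra.

Set Implicit Arguments.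
Unset Strict Implicit.
Unset Printing Implicit Defensive.
Import Order.TTheory GRing.Theory Num.Theory.

Local Open Scope ring_scope.

(** * The six-point inequality in Hilbert space *)

Section Ell2.
Context {R : realType}.
Implicit Types u v : ell2 R.

Lemma ell2_norm_ge0 u : 0 <= ell2_norm u.
Proof. by apply: fine_ge0; exact: Lnorm_ge0. Qed.

Lemma ell2_sum_sqr (s : seq (R * ell2 R)) : all (fun p => 0 <= p.1) s ->
  ((\sum_(p <- s) p.1 * ell2_norm p.2 ^+ 2)%:E =
   \sum_(n <oo) (\sum_(p <- s) p.1 * p.2 n ^+ 2)%:E)%E.
Proof.
elim: s => [_|[c u] s IH /= /andP[c0 s0]].
  rewrite big_nil; under eq_eseriesr do rewrite big_nil.
  by rewrite eseries0.
rewrite big_cons EFinD IH// EFinM ell2_norm_sqr -nneseriesZl//; last first.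
  by move=> n _; rewrite lee_fin sqr_ge0.
rewrite -nneseriesD; first last.
- move=> n _; rewrite lee_fin; elim: s s0 {IH} => [|p s IHs] /=.
    by rewrite big_nil.
  by move=> /andP[p0 s0]; rewrite big_cons addr_ge0 ?IHs// mulr_ge0// sqr_ge0.
- by move=> n _; rewrite lee_fin mulr_ge0// sqr_ge0.
by apply: eq_eseriesr => n _; rewrite big_cons -EFinM -EFinD.
Qed.

(** Quadratic inequalities between norms reduce to single coordinates. Negative terms must be moved
    across, since the series are summed in the extended reals. *)
Lemma ell2_sum_sqr_le (s t : seq (R * ell2 R)) :
  all (fun p => 0 <= p.1) s -> all (fun p => 0 <= p.1) t ->
  (forall n, \sum_(p <- s) p.1 * p.2 n ^+ 2 <=
             \sum_(p <- t) p.1 * p.2 n ^+ 2) ->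
  \sum_(p <- s) p.1 * ell2_norm p.2 ^+ 2 <=
  \sum_(p <- t) p.1 * ell2_norm p.2 ^+ 2.
Proof.
move=> s0 t0 st; rewrite -lee_fin !ell2_sum_sqr//; apply: lee_nneseries => n _.
  rewrite lee_fin; elim: s s0 {st} => [|p s IHs] /=; first by rewrite big_nil.
  by move=> /andP[p0 s0]; rewrite big_cons addr_ge0 ?IHs// mulr_ge0// sqr_ge0.
by rewrite lee_fin.
Qed.

(* Shaped like the unfolded weighted sums of [ell2_sum_sqr_le], whence the
   trivial factor and summands. *)
Lemma real_six_points (x0 x1 xa xb x2 x3 : R) :
  1 * (x0 - x3) ^+ 2 + (2 * (xa - xb) ^+ 2 + 0) <=
  4 * (x0 - x1) ^+ 2 + (4 * (x2 - x3) ^+ 2 + (2 * (x1 - xa) ^+ 2 +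
  (2 * (xa - x2) ^+ 2 + (2 * (x1 - xb) ^+ 2 + (2 * (xb - x2) ^+ 2 + 0))))).
Proof.
rewrite -subr_ge0.
(* The last square is the parallelogram defect of the cycle [p1], [pa], [p2], [pb]; the first two
   compare [x0 - x3] with its three successive increments. *)
rewrite [leRHS](_ : _ = (x1 - x2 - (x0 - x1) - (x2 - x3)) ^+ 2 +
  2 * (x0 - x1 - (x2 - x3)) ^+ 2 + 2 * (x1 - xa + (x2 - xb)) ^+ 2); last by ring.
by rewrite !addr_ge0 ?sqr_ge0// mulr_ge0 ?sqr_ge0.
Qed.

Lemma ell2_six_points (F : 'I_6 -> ell2 R) :
  ell2_norm (F p0 - F p3) ^+ 2 + 2 * ell2_norm (F pa - F pb) ^+ 2 <=
  4 * ell2_norm (F p0 - F p1) ^+ 2 + 4 * ell2_norm (F p2 - F p3) ^+ 2 +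
  2 * (ell2_norm (F p1 - F pa) ^+ 2 + ell2_norm (F pa - F p2) ^+ 2 +
       ell2_norm (F p1 - F pb) ^+ 2 + ell2_norm (F pb - F p2) ^+ 2).
Proof.
pose lhs := [:: (1, F p0 - F p3); (2, F pa - F pb)] : seq (R * ell2 R).
pose rhs := [:: (4, F p0 - F p1); (4, F p2 - F p3); (2, F p1 - F pa);
  (2, F pa - F p2); (2, F p1 - F pb); (2, F pb - F p2)] : seq (R * ell2 R).
suff : \sum_(p <- lhs) p.1 * ell2_norm p.2 ^+ 2 <=
       \sum_(p <- rhs) p.1 * ell2_norm p.2 ^+ 2.
  by rewrite !big_cons !big_nil /=; lra.
apply: ell2_sum_sqr_le.
- by rewrite /= ler01 ler0n.
- by rewrite /= !ler0n.
- move=> n; rewrite !big_cons !big_nil /=.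
  exact: (real_six_points (F p0 n) (F p1 n) (F pa n) (F pb n) (F p2 n) (F p3 n)).
Qed.

End Ell2.

(** * Lipschitz potentials on glued graphs and distance estimates *)

Section Glue.
Context {R : realType}.
Implicit Types G : stgraph.

(** Edges count as length 1 here; the factor [4 ^- i] enters only in [laakso_dist_ge]. *)
Definition edge_lipschitz G (g : vertex G -> R) :=
  forall x y, edge G x y -> `|g x - g y| <= 1.

Lemma edge_place G k u v :
  edge G u v -> edge (Defs.glue G) (place k u) (place k v).
Proof.
move=> uv; apply/existsP; exists k; apply/existsP; exists u.
by apply/existsP; exists v; rewrite uv !eqxx.
Qed.

Lemma placeP G k (P : vertex G -> glue_vertex G -> Prop) :
  P (src G) (inl (slot k).1) -> P (snk G) (inl (slot k).2) ->
  (forall w : inner G, P (val w) (inr (k, w))) -> forall v, P v (place k v).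
Proof.
move=> Ps Pt Pw v; rewrite /place; case: insubP => [w _ <-//|].
by rewrite negb_and !negbK; case: eqVneq => [->//|_ /= /eqP ->].
Qed.

(** Affine interpolation along each copy between the values at its gluing points; consistent when
    [g] runs from 0 at the source to [M] at the sink. *)
Definition interp G (Q : 'I_6 -> R) (M : R) (g : vertex G -> R)
    (x : vertex (Defs.glue G)) : R :=
  match x with
  | inl q => Q q * M
  | inr (k, w) => Q (slot k).1 * M + (Q (slot k).2 - Q (slot k).1) * g (val w)
  end.

Lemma interp_lipschitz G Q M (g : vertex G -> R) :
  g (src G) = 0 -> g (snk G) = M -> edge_lipschitz g ->
  (forall k, `|Q (slot k).2 - Q (slot k).1| <= 1) ->
  edge_lipschitz (interp Q M g).
Proof.
move=> gs gt gL QL x y.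
have interp_place k v : interp Q M g (place k v) =
    Q (slot k).1 * M + (Q (slot k).2 - Q (slot k).1) * g v.
  apply: (placeP (P := fun v x => interp Q M g x =
    Q (slot k).1 * M + (Q (slot k).2 - Q (slot k).1) * g v)) => //=.
    by rewrite gs mulr0 addr0.
  by rewrite gt; ring.
move=> /existsP[k /existsP[u /existsP[v /and3P[uv /eqP-> /eqP->]]]].
rewrite !interp_place opprD addrACA subrr add0r -mulrBr normrM.
by rewrite mulr_ile1// gL.
Qed.

Definition height (q : 'I_6) : nat := nth 0%N [:: 0; 1; 2; 2; 3; 4]%N q.

(* Distance from [pa] on the six gluing points, capped at its value at [p1] and
   [p2] on the two hanging copies. *)
Definition dist_pa (q : 'I_6) : nat := nth 0%N [:: 1; 1; 0; 2; 1; 1]%N q.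

Lemma ord6_ind (P : 'I_6 -> Prop) :
  P p0 -> P p1 -> P pa -> P pb -> P p2 -> P p3 -> forall k, P k.
Proof.
move=> h0 h1 ha hb h2 h3; case=> [] [|[|[|[|[|[|//]]]]]] k6;
  by rewrite (bool_irrelevance k6 isT).
Qed.

Lemma height_slot k : height (slot k).2 = (height (slot k).1).+1.
Proof. by move: k; apply: ord6_ind. Qed.

(* Layer h of the glued graph is folded onto one copy of G, everything below it
   is collapsed to the source and everything above it to the sink. *)
Definition fold_glue G (h : nat) (x : vertex (Defs.glue G)) : vertex G :=
  match x with
  | inl q => if (height q <= h)%N then src G else snk G
  | inr (k, w) => if (height (slot k).1 < h)%N then src G else
                  if height (slot k).1 == h then val w else snk G
  end.

Lemma fold_glue_place G h k (v : vertex G) :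
  fold_glue h (place k v) =
    if (height (slot k).1 < h)%N then src G else
    if height (slot k).1 == h then v else snk G.
Proof.
pose D (u : vertex G) := if (height (slot k).1 < h)%N then src G else
  if height (slot k).1 == h then u else snk G.
by apply: (placeP (P := fun u x => fold_glue h x = D u)) => //=;
  rewrite /D ?height_slot; case: ltngtP.
Qed.

(** Folding sends each edge to an edge or to a single vertex. *)
Lemma fold_glue_lipschitz G h (g : vertex G -> R) :
  edge_lipschitz g -> edge_lipschitz (g \o fold_glue h).
Proof.
move=> gL x y.
move=> /existsP[k /existsP[u /existsP[v /and3P[uv /eqP-> /eqP->]]]] /=.
by rewrite !fold_glue_place; case: ltngtP => _; rewrite ?subrr ?normr0// gL.
Qed.

Fixpoint laakso_height i : vertex (laakso i) -> R :=
  if i is j.+1 return vertex (laakso i) -> R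
  then interp (fun q => (height q)%:R) (4 ^+ j) (laakso_height (i := j))
  else fun b : bool => b%:R.

Lemma laakso_height_src i : laakso_height (src (laakso i)) = 0.
Proof. by case: i => [//|i] /=; rewrite mul0r. Qed.

Lemma laakso_height_snk i : laakso_height (snk (laakso i)) = 4 ^+ i.
Proof. by case: i => [//|i] /=; rewrite exprS. Qed.

Lemma laakso_height_lipschitz i : edge_lipschitz (@laakso_height i).
Proof.
elim: i => [|i IH].
  by move=> [] [] //= _; rewrite ?subr0 ?sub0r ?normrN normr1.
apply: interp_lipschitz IH _; rewrite ?laakso_height_src ?laakso_height_snk//.
by move=> k; rewrite height_slot -addn1 natrD addrAC subrr add0r normr1.
Qed.

(** Witnesses that [pa] and [pb] are at least [2 * 4 ^+ i] edges apart: it is 0 at the former and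
    [2 * 4 ^+ i] at the latter. *)
Definition laakso_dist_pa i : vertex (laakso i.+1) -> R :=
  interp (fun q => (dist_pa q)%:R) (4 ^+ i) (@laakso_height i).

Lemma laakso_dist_pa_lipschitz i : edge_lipschitz (@laakso_dist_pa i).
Proof.
apply: interp_lipschitz; rewrite ?laakso_height_src ?laakso_height_snk//.
  exact: laakso_height_lipschitz.
by apply: ord6_ind; rewrite /dist_pa /= ler_norml; apply/andP; split; lra.
Qed.

(** Telescoping along a walk: [g] changes by at most 1 per edge. *)
Lemma laakso_dist_ge i (g : vertex (laakso i) -> R) x y :
  edge_lipschitz g -> `|g x - g y| / 4 ^+ i <= laakso_dist R i x y.
Proof.
move=> gL; apply: lb_le_inf.
  by have [p xp py] := laakso_connected x y; 
  exists ((size p)%:R / 4 ^+ i); exists p.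
move=> _ [p [xp py] <-]; rewrite ler_pM2r ?invr_gt0 ?exprn_gt0//.
elim: p x xp py => [|z p IH] x /= => [_ ->|/andP[xz zp] py].
  by rewrite subrr normr0.
rewrite (le_trans (ler_distD (g z) _ _))// -add1n natrD lerD ?gL//.
exact: IH.
Qed.

Lemma laakso_dist_edge i (x y : vertex (laakso i)) :
  edge (laakso i) x y -> laakso_dist R i x y <= (4 ^+ i)^-1.
Proof.
move=> xy; apply: ge_inf.
  exists 0 => _ [p _ <-]; by rewrite divr_ge0// exprn_ge0.
by exists [:: y]; rewrite /= ?xy ?mul1r.
Qed.

End Glue.

(* The distances in G_i enter through 1-Lipschitz potentials because these lift
   from a copy to the whole graph along the retraction [fold_glue]. *)
Lemma laakso_sqr_sum (R : realType) (n : nat) (f : vertex (laakso n) -> ell2 R)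
    (L : R) (w : nat -> R) :
  (forall x y, edge (laakso n) x y -> ell2_norm (f x - f y) ^+ 2 <= L) ->
  (forall j x y (g : vertex (laakso n) -> R), (j < n)%N -> edge_lipschitz g ->
     `|g x - g y| = 2 * 4 ^+ j -> w j <= ell2_norm (f x - f y) ^+ 2) ->
  ell2_norm (f (src (laakso n)) - f (snk (laakso n))) ^+ 2 +
    \sum_(j < n) 2 * 16 ^+ (n - j.+1) * w j <= 16 ^+ n * L.
Proof.
elim: n f => [|n IH] f fL fw.
  by rewrite big_ord0 addr0 expr0 mul1r fL.
pose S := \sum_(j < n) 2 * 16 ^+ (n - j.+1) * w j.
have slotP k : ell2_norm (f (inl (slot k).1) - f (inl (slot k).2)) ^+ 2 + S <=
    16 ^+ n * L.
  rewrite -(place_src (laakso n)) -(place_snk k (laakso_src_snk n)).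
  apply: (IH (fun v => f (place k v))) => [x y xy|j x y g jn gL gxy].
    by apply: fL; exact: edge_place.
  (* Folding at the layer of the copy restricts to the identity on it, so [g] extends to the whole
     graph with the same separation of [x] and [y]. *)
  pose h := height (slot k).1.
  apply: (fw j _ _ (g \o fold_glue h)); first exact: ltnW.
    exact: fold_glue_lipschitz.
  by rewrite /= !fold_glue_place ltnn eqxx.
have ab : w n <= ell2_norm (f (inl pa) - f (inl pb)) ^+ 2.
  apply: (fw n _ _ (@laakso_dist_pa R n)) => //.
    exact: laakso_dist_pa_lipschitz.
  by rewrite /= /dist_pa /= mul0r sub0r normrN ger0_norm// mulr_ge0// exprn_ge0.
(* One more level multiplies the old weights by 16, the total weight of the six copies, and adds the
   new coarsest scale with weight 2. *)
have SE : \sum_(j < n.+1) 2 * 16 ^+ (n.+1 - j.+1) * w j = 16 * S + 2 * w n.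
  rewrite big_ord_recr /= subnn expr0 mulr1 mulr_sumr; congr (_ + _).
  apply: eq_bigr => j _.
  by rewrite subSS -(subnSK (ltn_ord j)) exprS; ring.
rewrite {}SE (exprS 16) -[leRHS]mulrA.
have := ell2_six_points (fun q => f (inl q)).
(* Here [p0] to [p3] serve as slot numbers. The outer slots get weight 4, the four cycle slots
   weight 2. *)
move: (slotP p0) (slotP p1) (slotP pa) (slotP pb) (slotP p2) (slotP p3).
rewrite /slot !(tnth_nth (p0, p0)) /=.
by move: (16 ^+ n * L) => T h0 h1 h2 h3 h4 h5 h6; move: ab; lra.
Qed.

(** * From the multiscale inequality to the distortion bound *)

Lemma laakso_distortion_sqr (R : realType) (n : nat) (e D s : R)
    (f : vertex (laakso n) -> ell2 R) : 0 < e -> e < 1 -> 0 < s ->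
  (forall x y, let r := laakso_dist R n x y `^ (1 - e) in
    s * r <= ell2_norm (f x - f y) <= D * s * r) ->
  1 <= D /\ n%:R / 2 <= D ^+ 2 * 16 `^ (n%:R * e).
Proof.
move=> e0 e1 s0 fD.
have n4 : 0 < 4 ^+ n :> R by rewrite exprn_gt0.
have e'0 : 0 <= 1 - e by rewrite subr_ge0 ltW.
have dist0 x y : 0 <= laakso_dist R n x y.
  apply: (le_trans _ (laakso_dist_ge _ _ (@laakso_height_lipschitz R n))).
  by rewrite divr_ge0// ltW.
(* The source and the sink have positive distance, so the two bounds on their images can be
   compared. *)
have D1 : 1 <= D.
  have /andP[] := fD (src _) (snk _); move=> /le_trans /[apply].
  rewrite -mulrA ler_pMl// mulr_gt0// powR_gt0//.
  rewrite (lt_le_trans _ (laakso_dist_ge _ _ (@laakso_height_lipschitz R n)))//.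
  by rewrite laakso_height_src laakso_height_snk sub0r normrN gtr0_norm// divff ?gt_eqF.
have D0 : 0 <= D by exact: le_trans D1.
split=> //.
have E16 m : 16 ^+ m = 4 ^+ m * 4 ^+ m :> R by rewrite -exprMn; congr (_ ^+ _); ring.
pose L := (D * s * (4 ^+ n)^-1 `^ (1 - e)) ^+ 2.
pose w j := (s * (2 * 4 ^+ j / 4 ^+ n)) ^+ 2.
have fL x y : edge (laakso n) x y -> ell2_norm (f x - f y) ^+ 2 <= L.
  move=> xy; have /andP[_ fxy] := fD x y.
  rewrite ler_sqr ?nnegrE ?ell2_norm_ge0//; last first.
    by rewrite mulr_ge0 ?powR_ge0// mulr_ge0// ltW.
  apply: (le_trans fxy); rewrite ler_wpM2l//; first by rewrite mulr_ge0// ltW.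
  apply: ge0_ler_powR; rewrite ?nnegrE ?invr_ge0 ?(ltW n4)//.
  exact: laakso_dist_edge.
have fw j x y (g : vertex (laakso n) -> R) : (j < n)%N -> edge_lipschitz g ->
     `|g x - g y| = 2 * 4 ^+ j -> w j <= ell2_norm (f x - f y) ^+ 2.
  move=> jn gL gxy; have /andP[fxy _] := fD x y.
  have := laakso_dist_ge x y gL; rewrite gxy; set d := _ / _ => dxy.
  have d0 : 0 < d by rewrite divr_gt0// mulr_gt0// exprn_gt0.
  have d1 : d <= 1.
    rewrite ler_pdivrMr// mul1r -(subnK jn) addnS exprS exprD.
    rewrite mulrA ler_wpM2r ?exprn_ge0//.
    rewrite (le_trans (_ : 2 <= 4 * 1))// ?ler_wpM2l// ?exprn_ege1//; lra.
  rewrite ler_sqr ?nnegrE ?ell2_norm_ge0//; last by rewrite mulr_ge0// ltW.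
  apply: le_trans fxy; rewrite ler_wpM2l ?(ltW s0)//.
  (* Since [d <= 1], lowering the exponent from 1 to [1 - e] only increases the power. *)
  rewrite (@le_trans _ _ (d `^ (1 - e)))//.
    rewrite -[leLHS]powRr1 ?(ltW d0)// ger_powR ?d0//; lra.
  by rewrite ge0_ler_powR ?nnegrE ?(ltW d0).
have := laakso_sqr_sum fL fw.
(* The powers of 16 cancel, so every scale contributes exactly [s ^+ 2 / 2]. *)
have -> : \sum_(j < n) 2 * 16 ^+ (n - j.+1) * w j = n%:R * (s ^+ 2 / 2).
  rewrite mulr_natl -[in RHS](card_ord n) -sumr_const; apply: eq_bigr => j _.
  rewrite E16 /w; rewrite -[X in _ / 4 ^+ X](subnK (ltn_ord j)) addnS (exprS 4) exprD.
  have := exprn_gt0 j (ltr0n R 4); have := exprn_gt0 (n - j.+1) (ltr0n R 4).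
  by move=> /= /lt0r_neq0 a0 /lt0r_neq0 b0; field; rewrite a0 b0.
have -> : 16 ^+ n * L = s ^+ 2 * (D ^+ 2 * 16 `^ (n%:R * e)).
  rewrite powRrM powR_mulrn// E16 powRM ?(ltW n4)// /L.
  rewrite -(powR_inv1 (ltW n4)) -powRrM mulN1r opprB powRB ?(gt_eqF n4) ?implybT//.
  rewrite powRr1 ?(ltW n4)//; field; exact: lt0r_neq0.
move=> H; rewrite -(@ler_pM2l _ (s ^+ 2)) ?exprn_gt0//; apply: le_trans H.
rewrite [leLHS](_ : _ = n%:R * (s ^+ 2 / 2)); last by ring.
by rewrite lerDr sqr_ge0.
Qed.

Theorem mainTheorem5 (R : realType) (A : R) (hA : 1 <= A) :
  exists c : R, 0 < c /\
    forall (eps : R) (i : nat),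
      0 < eps -> eps < 1 ->
      1 / (A * eps) <= i%:R -> i%:R <= A / eps ->
      forall f : vertex (laakso i) -> ell2 R,
        ((c / Num.sqrt eps)%:E <=
         distortion (fun x y => (laakso_dist R i x y `^ (1 - eps))%R) f)%E.
Proof.
have A0 : 0 < A by exact: lt_le_trans hA.
pose K : R := 2 * A * 16 `^ A.
have K0 : 0 < K by rewrite !mulr_gt0// powR_gt0.
exists (Num.sqrt K^-1); split; first by rewrite sqrtr_gt0 invr_gt0.
move=> eps i e0 e1 ilo ihi f.
apply: le_ereal_inf_tmp => _ [D [s s0 fD] <-]; rewrite lee_fin.
have [D1 iD] := laakso_distortion_sqr e0 e1 s0 fD.
have D0 : 0 <= D by exact: le_trans D1.
rewrite -sqrtrV ?(ltW e0)// -sqrtrM ?invr_ge0 ?(ltW K0)//.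
rewrite -(ger0_norm D0) -sqrtr_sqr; apply: ler_wsqrtr.
(* The upper bound on [i] keeps the snowflaking loss bounded; the lower bound then supplies enough
   scales. *)
have i16 : 16 `^ (i%:R * eps) <= 16 `^ A :> R.
  by rewrite ler_powR ?ler1n// -ler_pdivlMr.
have {}iD : i%:R / 2 <= D ^+ 2 * 16 `^ A.
  by rewrite (le_trans iD)// ler_wpM2l// sqr_ge0.
have P0 : 0 < 16 `^ A :> R by rewrite powR_gt0.
have {}iD : 1 / (A * eps) / 2 <= D ^+ 2 * 16 `^ A.
  by rewrite (le_trans _ iD)// ler_wpM2r// invr_ge0.
rewrite -(ler_pM2r P0) (le_trans _ iD)// le_eqVlt; apply/orP; left; apply/eqP.
by rewrite /K; field; rewrite !gt_eqF.
Qed.
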